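(* Let $(p,q,u)$ be a solution returned by the tailored penalty alternating direction method (described in the context). Then there is some $(v,\Delta,\theta,\tau,\phi)$ such that $(p,q,u,v,\Delta,\theta,\tau,\phi)$ is feasible for the problem SCUC-ACOPF.
   Context: **Index sets.** $\mathcal T=\{1,\dots,T\}$ are time periods with lengths $d_t>0$. $\mathcal J^{\mathrm{pr}},\mathcal J^{\mathrm{cs}}$ are disjoint finite sets of producing and consuming devices, $\mathcal J^{\mathrm{sd}}=\mathcal J^{\mathrm{pr}}\cup\mathcal J^{\mathrm{cs}}$; $\mathcal I$ is the finite set of buses; $\mathcal J^{\mathrm{ac}},\mathcal J^{\mathrm{dc}}$ are the finite sets of AC and DC branches, $\mathcal J^{\mathrm{br}}$ their disjoint union, branch $j$ going from bus $i_j$ to bus $i'_j$; $\mathcal J^{\mathrm{sh}}$ is the finite set of shunts; each device or shunt $j$ sits at bus $i_j$; $\mathcal R$ is a finite set of real reserve products. $[x]^+=\max\{x,0\}$. A subscript $j$, $t$ (or $i$) on $p,q,u$ denotes the sub-collection of variables with that index (or with index $j$ such that $i_j=i$). **Device constraints** ($j\in\mathcal J^{\mathrm{sd}}$, $t\in\mathcal T$; $u^{\mathrm{on}}_{j0}\in\{0,1\}$ and $p^{\mathrm{tot}}_{j0}=\overline p^{\mathrm{tot}}_{j0}$ are data). Data: $p^{\mathrm{supc}}_{jtt'},p^{\mathrm{sdpc}}_{jtt'}\ge0$, $\mathcal T^{\mathrm{supc}}_{jt}=\{t'\in\mathcal T:t'>t,\ p^{\mathrm{supc}}_{jtt'}>0\}$,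 $\mathcal T^{\mathrm{sdpc}}_{jt}=\{t'\in\mathcal T:t'\le t,\ p^{\mathrm{sdpc}}_{jtt'}>0\}$; polyhedra $\mathcal X^{\mathrm u}_j$ (linear commitment rules) and $\mathcal X^{\mathrm p}_{jt}$ (linear power/reserve bounds); reals $q^{\max}_{jt},q^{\min}_{jt},\beta^{\max}_j,\beta^{\min}_j$ and ramp rates $p^{\mathrm{ru}}_j,p^{\mathrm{rd}}_j,p^{\mathrm{ru,su}}_j,p^{\mathrm{rd,sd}}_j$. (U) $u^{\mathrm{on}}_{jt}-u^{\mathrm{on}}_{j,t-1}=u^{\mathrm{su}}_{jt}-u^{\mathrm{sd}}_{jt}$; $u^{\mathrm{su}}_{jt}+u^{\mathrm{sd}}_{jt}\le1$; $\{u^{\mathrm{on}}_{jt},u^{\mathrm{su}}_{jt},u^{\mathrm{sd}}_{jt}\}_{t\in\mathcal T}\in\mathcal X^{\mathrm u}_j$; $u^{\mathrm{on}}_{jt},u^{\mathrm{su}}_{jt},u^{\mathrm{sd}}_{jt}\in\{0,1\}$. (P1) $p^{\mathrm{tot}}_{jt}=p^{\mathrm{on}}_{jt}+p^{\mathrm{su}}_{jt}+p^{\mathrm{sd}}_{jt}$. (P2) $p^{\mathrm{su}}_{jt}=\sum_{t'\in\mathcal T^{\mathrm{supc}}_{jt}}p^{\mathrm{supc}}_{jtt'}u^{\mathrm{su}}_{jt'}$, $p^{\mathrm{sd}}_{jt}=\sum_{t'\in\mathcal T^{\mathrm{sdpc}}_{jt}}p^{\mathrm{sdpc}}_{jtt'}u^{\mathrm{sd}}_{jt'}$.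 (P3) $(u^{\mathrm{on}}_{jt},p^{\mathrm{tot}}_{jt},p^{\mathrm{on}}_{jt},\{p^{\mathrm{res}}_{jtr}\}_{r\in\mathcal R})\in\mathcal X^{\mathrm p}_{jt}$. (P4) $p^{\mathrm{tot}}_{jt},p^{\mathrm{on}}_{jt},p^{\mathrm{res}}_{jtr}\ge0$. (Q) With $\sigma_{jt}:=u^{\mathrm{on}}_{jt}+\sum_{t'\in\mathcal T^{\mathrm{supc}}_{jt}}u^{\mathrm{su}}_{jt'}+\sum_{t'\in\mathcal T^{\mathrm{sdpc}}_{jt}}u^{\mathrm{sd}}_{jt'}$: $q^{\mathrm{tot}}_{jt}\le q^{\max}_{jt}\sigma_{jt}+\beta^{\max}_jp^{\mathrm{tot}}_{jt}-q^{\mathrm{res}}_{jta}$ and $q^{\mathrm{tot}}_{jt}\ge q^{\min}_{jt}\sigma_{jt}+\beta^{\min}_jp^{\mathrm{tot}}_{jt}+q^{\mathrm{res}}_{jtb}$, where $(a,b)=(\uparrow,\downarrow)$ if $j\in\mathcal J^{\mathrm{pr}}$ and $(a,b)=(\downarrow,\uparrow)$ if $j\in\mathcal J^{\mathrm{cs}}$; $q^{\mathrm{res}}_{jt\uparrow},q^{\mathrm{res}}_{jt\downarrow}\ge0$. (R) $-r^{\mathrm d}_{jt}(u)\le p^{\mathrm{tot}}_{jt}-p^{\mathrm{tot}}_{j,t-1}\le r^{\mathrm u}_{jt}(u)$, where $r^{\mathrm d}_{jt}(u)=d_t\big(p^{\mathrm{rd}}_ju^{\mathrm{on}}_{jt}+p^{\mathrm{rd,sd}}_j(1-u^{\mathrm{on}}_{jt})\big)$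 and $r^{\mathrm u}_{jt}(u)=d_t\big(p^{\mathrm{ru}}_j(u^{\mathrm{on}}_{jt}-u^{\mathrm{su}}_{jt})+p^{\mathrm{ru,su}}_j(u^{\mathrm{su}}_{jt}-u^{\mathrm{on}}_{jt}+1)\big)$. **Network constraints** ($t\in\mathcal T$; $g,b$ with indices are real data). (F1) For $j\in\mathcal J^{\mathrm{ac}}$: $\Delta_{jt}=\theta_{i_jt}-\theta_{i'_jt}-\phi_{jt}$; $p^{\mathrm{fr}}_{jt}=v_{i_jt}\big(g_{i_jj}v_{i_jt}/\tau_{jt}^2+\frac{v_{i'_jt}}{\tau_{jt}}(-g_j\cos\Delta_{jt}-b_j\sin\Delta_{jt})\big)$; $p^{\mathrm{to}}_{jt}=v_{i'_jt}\big(g_{i'_jj}v_{i'_jt}+\frac{v_{i_jt}}{\tau_{jt}}(-g_j\cos\Delta_{jt}+b_j\sin\Delta_{jt})\big)$; $q^{\mathrm{fr}}_{jt}=v_{i_jt}\big(-b_{i_jj}v_{i_jt}/\tau_{jt}^2+\frac{v_{i'_jt}}{\tau_{jt}}(b_j\cos\Delta_{jt}-g_j\sin\Delta_{jt})\big)$; $q^{\mathrm{to}}_{jt}=v_{i'_jt}\big(-b_{i'_jj}v_{i'_jt}+\frac{v_{i_jt}}{\tau_{jt}}(b_j\cos\Delta_{jt}+g_j\sin\Delta_{jt})\big)$. (F2) $p^{\mathrm{fr}}_{jt}+p^{\mathrm{to}}_{jt}=0$ for $j\in\mathcal J^{\mathrm{dc}}$; $p^{\mathrm{sh}}_{jt}=g^{\mathrm{sh}}_ju^{\mathrm{sh}}_{jt}v_{i_jt}^2$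 and $q^{\mathrm{sh}}_{jt}=-b^{\mathrm{sh}}_ju^{\mathrm{sh}}_{jt}v_{i_jt}^2$ for $j\in\mathcal J^{\mathrm{sh}}$. (F3) $v_{it}\in[v^{\min}_i,v^{\max}_i]$ for $i\in\mathcal I$; $\phi_{jt}\in[\phi^{\min}_j,\phi^{\max}_j]$, $\tau_{jt}\in[\tau^{\min}_j,\tau^{\max}_j]$ for $j\in\mathcal J^{\mathrm{ac}}$; and (DC) $p^{\mathrm{fr}}_{jt},p^{\mathrm{to}}_{jt}\in[-p^{\max}_j,p^{\max}_j]$, $q^{\mathrm{fr}}_{jt}\in[q^{\mathrm{fr,min}}_j,q^{\mathrm{fr,max}}_j]$, $q^{\mathrm{to}}_{jt}\in[q^{\mathrm{to,min}}_j,q^{\mathrm{to,max}}_j]$ for $j\in\mathcal J^{\mathrm{dc}}$; the voltage and tap bounds are positive. (F4) $u^{\mathrm{sh}}_{jt}\in[u^{\mathrm{sh,min}}_j,u^{\mathrm{sh,max}}_j]\cap\mathbb Z_+$ for $j\in\mathcal J^{\mathrm{sh}}$, with integral bounds. **Objective terms.** $C^{\mathrm{uc}}_j(u)=\sum_{t}\big(c^{\mathrm{on}}_{jt}u^{\mathrm{on}}_{jt}+c^{\mathrm{su}}_ju^{\mathrm{su}}_{jt}+c^{\mathrm{sd}}_ju^{\mathrm{sd}}_{jt}-\sum_{t'<t}c^{\mathrm{dd}}_{jtt'}[u^{\mathrm{su}}_{jt}+u^{\mathrm{on}}_{jt'}-1]^+\big)$ with $c^{\mathrm{su}}_j,c^{\mathrm{sd}}_j,c^{\mathrm{dd}}_{jtt'}\ge0$.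 $C^{\mathrm e}_j(p)=c^{\mathrm e}\big(\sum_{W\in\mathcal W^{\mathrm{en,min}}_j}[e^{\min}_j(W)-\sum_{t\in W}d_tp^{\mathrm{tot}}_{jt}]^++\sum_{W\in\mathcal W^{\mathrm{en,max}}_j}[-e^{\max}_j(W)+\sum_{t\in W}d_tp^{\mathrm{tot}}_{jt}]^+\big)$, $c^{\mathrm e}\ge0$, with finite families of nonempty subsets of $\mathcal T$. $C^{\mathrm{pow}}_{jt}$ ($j\in\mathcal J^{\mathrm{pr}}$) is a convex and $R^{\mathrm{pow}}_{jt}$ ($j\in\mathcal J^{\mathrm{cs}}$) a concave piecewise linear function of $p^{\mathrm{tot}}_{jt}$. $C^{\mathrm{res}}_t(p,q)=d_t\Big(\sum_{j,r}c^{\mathrm{res,p}}_{jtr}p^{\mathrm{res}}_{jtr}+\sum_{R'\subset\mathcal R}c^{\mathrm{res}}_{R'}\sum_{N\in\mathcal N^{\mathrm p}}\big[p^{\mathrm{res,min}}_t(p;R',N)-\sum_{r\in R'}\sum_{j\in N}p^{\mathrm{res}}_{jtr}\big]^++\sum_{r\in\{\uparrow,\downarrow\}}\big(\sum_jc^{\mathrm{res,q}}_{jtr}q^{\mathrm{res}}_{jtr}+c^{\mathrm{res}}_r\sum_{N\in\mathcal N^{\mathrm q}}[q^{\mathrm{res,min}}_t(q;r,N)-\sum_{j\in N}q^{\mathrm{res}}_{jtr}]^+\big)\Big)$, where $\mathcal N^{\mathrm p},\mathcal N^{\mathrm q}$ are finite families of subsets of $\mathcal J^{\mathrm{sd}}$,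 the coefficients $c^{\mathrm{res}}$ are nonnegative, and each requirement function is a constant, or a nonnegative multiple of the sum or of the maximum over $j\in N$ of the period-$t$ injections. $C^{\mathrm{ac}}_{jt}(p,q)=c^{\mathrm s}d_t\big[\max\{\|(p^{\mathrm{fr}}_{jt},q^{\mathrm{fr}}_{jt})\|_2,\|(p^{\mathrm{to}}_{jt},q^{\mathrm{to}}_{jt})\|_2\}-s^{\max}_j\big]^+$, $c^{\mathrm s}\ge0$. $C^{\mathrm{bal}}_{it}(p,q)=d_t(c^{\mathrm p}|B_{it}(p)|+c^{\mathrm q}|B_{it}(q)|)$, $c^{\mathrm p},c^{\mathrm q}\ge0$, where for $x\in\{p,q\}$, $B_{it}(x)=\sum_{j\in\mathcal J^{\mathrm{pr}},i_j=i}x^{\mathrm{tot}}_{jt}-\sum_{j\in\mathcal J^{\mathrm{cs}},i_j=i}x^{\mathrm{tot}}_{jt}-\sum_{j\in\mathcal J^{\mathrm{sh}},i_j=i}x^{\mathrm{sh}}_{jt}-\sum_{j\in\mathcal J^{\mathrm{br}},i_j=i}x^{\mathrm{fr}}_{jt}-\sum_{j\in\mathcal J^{\mathrm{br}},i'_j=i}x^{\mathrm{to}}_{jt}$. $C^{\mathrm{ctg}}_t=\frac1K\sum_{k\in\mathcal K}C^{\mathrm{ctg}}_{kt}+\max_{k\in\mathcal K}C^{\mathrm{ctg}}_{kt}$, $\mathcal K=\{1,\dots,K\}$, $C^{\mathrm{ctg}}_{kt}(p,q)=c^{\mathrm s}d_t\sum_{j\in\mathcal J^{\mathrm{ac}},j\ne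 j_k}\big[\|(f_{kjt}(p),\max\{|q^{\mathrm{fr}}_{jt}|,|q^{\mathrm{to}}_{jt}|\})\|_2-s^{\mathrm{max,ctg}}_j\big]^+$, $f_{kjt}(p)=\sum_{i\in\mathcal I}h_{kjit}(p)$, $h_{kjit}(p)=F_{kji}\big(p^{\mathrm{inj}}_{it}(p)-\frac1{|\mathcal I|}\sum_{i'\in\mathcal I}p^{\mathrm{inj}}_{i't}(p)\big)$ with real data $F_{kji}$, $j_k\in\mathcal J^{\mathrm{ac}}$, and $p^{\mathrm{inj}}_{it}(p)$ equal to $B_{it}(p)$ with the sums over $\mathcal J^{\mathrm{br}}$ restricted to $\mathcal J^{\mathrm{dc}}$. $R^{\mathrm T}_t=-C^{\mathrm{res}}_t-C^{\mathrm{ctg}}_t-\sum_{j\in\mathcal J^{\mathrm{ac}}}C^{\mathrm{ac}}_{jt}-\sum_{i\in\mathcal I}C^{\mathrm{bal}}_{it}$; $R^{\mathrm J}_j=-C^{\mathrm{uc}}_j-C^{\mathrm e}_j+\sum_tR^{\mathrm{pow}}_{jt}$ if $j\in\mathcal J^{\mathrm{cs}}$, and $R^{\mathrm J}_j=-C^{\mathrm{uc}}_j-C^{\mathrm e}_j-\sum_tC^{\mathrm{pow}}_{jt}$ if $j\in\mathcal J^{\mathrm{pr}}$. **SCUC-ACOPF**: maximize $\sum_tR^{\mathrm T}_t(p,q)+\sum_{j\in\mathcal J^{\mathrm{sd}}}R^{\mathrm J}_j(p,u)$ over $(p,q,u,v,\Delta,\theta,\tau,\phi)$ subject to (U), (P1)–(P4),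 (Q), (R), (F1)–(F4). **Standing assumption.** (1) $c^{\mathrm{su}}_j\ge\sum_{t'<t}c^{\mathrm{dd}}_{jtt'}$ for all $j,t$. (2) For each $j\in\mathcal J^{\mathrm{sd}}$, every $u_j$ satisfying (U) satisfies $u^{\mathrm{on}}_{jt}+\sum_{t'\in\mathcal T^{\mathrm{supc}}_{jt}}u^{\mathrm{su}}_{jt'}\le1$ and $u^{\mathrm{on}}_{jt}+\sum_{t'\in\mathcal T^{\mathrm{sdpc}}_{jt}}u^{\mathrm{sd}}_{jt'}\le1$ for all $t$. (3) The sets $\mathcal X^{\mathrm p}_{jt}$ are closed, convex, bounded and polyhedral. (4) SCUC-ACOPF is feasible with nonnegative optimal value. **Sets.** $\mathcal X^{\mathrm{uc}}_j=\{(p_j,q_j,u_j):\text{(U),(P1)–(P4),(Q),(R) for device }j\}$; $\mathcal X^{\mathrm{ac}}_t=\{(p_t,q_t,u^{\mathrm{sh}}_t):\exists(v_t,\Delta_t,\theta_t,\tau_t,\phi_t)\text{ with (F1)–(F3) at }t\}$. $\mathcal X^{\mathrm{soc}}_t$ is the set of $(p_t,q_t,\mu_t,\omega_t)$ for which there exist $(c_t,s_t)$ with: for $j\in\mathcal J^{\mathrm{ac}}$, $p^{\mathrm{fr}}_{jt}=g_{i_jj}\mu_{jt}-g_jc_{jt}-b_js_{jt}$, $p^{\mathrm{to}}_{jt}=g_{i'_jj}\omega_{i'_jt}-g_jc_{jt}+b_js_{jt}$, $q^{\mathrm{fr}}_{jt}=-b_{i_jj}\mu_{jt}+b_jc_{jt}-g_js_{jt}$,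 $q^{\mathrm{to}}_{jt}=-b_{i'_jj}\omega_{i'_jt}+b_jc_{jt}+g_js_{jt}$, $c_{jt}^2+s_{jt}^2\le\mu_{jt}\omega_{i'_jt}$, $\omega_{i_jt}/(\tau^{\max}_j)^2\le\mu_{jt}\le\omega_{i_jt}/(\tau^{\min}_j)^2$; for $j\in\mathcal J^{\mathrm{sh}}$, $p^{\mathrm{sh}}_{jt}=g^{\mathrm{sh}}_j\mu^{\mathrm{sh}}_{jt}$, $q^{\mathrm{sh}}_{jt}=-b^{\mathrm{sh}}_j\mu^{\mathrm{sh}}_{jt}$, $u^{\mathrm{sh,min}}_j\omega_{i_jt}\le\mu^{\mathrm{sh}}_{jt}\le u^{\mathrm{sh,max}}_j\omega_{i_jt}$; $\omega_{it}\in[(v^{\min}_i)^2,(v^{\max}_i)^2]$ for $i\in\mathcal I$; and $p^{\mathrm{fr}}_{jt}+p^{\mathrm{to}}_{jt}=0$ and (DC) for $j\in\mathcal J^{\mathrm{dc}}$. $\overline{\mathcal Y}^{\mathrm{uc}}_{jt}$ is the set of $(p_{jt},q_{jt},u^{\mathrm{on}}_{jt},\chi_{jt})$, $\chi_{jt}=(\chi^{\mathrm{su}}_{jt},\chi^{\mathrm{sd}}_{jt})$, satisfying (P1), (P3), (P4), $0\le p^{\mathrm{su}}_{jt}\le\chi^{\mathrm{su}}_{jt}\max_{t'\in\mathcal T^{\mathrm{supc}}_{jt}}p^{\mathrm{supc}}_{jtt'}$, $0\le p^{\mathrm{sd}}_{jt}\le\chi^{\mathrm{sd}}_{jt}\max_{t'\in\mathcal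 T^{\mathrm{sdpc}}_{jt}}p^{\mathrm{sdpc}}_{jtt'}$, (Q) with $\sigma_{jt}$ replaced by $u^{\mathrm{on}}_{jt}+\chi^{\mathrm{su}}_{jt}+\chi^{\mathrm{sd}}_{jt}$, $u^{\mathrm{on}}_{jt}+\chi^{\mathrm{su}}_{jt}\le1$, $u^{\mathrm{on}}_{jt}+\chi^{\mathrm{sd}}_{jt}\le1$, $(u^{\mathrm{on}}_{jt},\chi_{jt})\in[0,1]^3$; if $\mathcal T^{\mathrm{supc}}_{jt}=\emptyset$ (resp. $\mathcal T^{\mathrm{sdpc}}_{jt}=\emptyset$) then $\chi^{\mathrm{su}}_{jt}=0$ (resp. $\chi^{\mathrm{sd}}_{jt}=0$) and the maximum is read as $0$. **Subproblems.** $\Gamma'_\ell(p,q,u,\overline p,\overline q,\overline u)=\|(p^{\mathrm{tot}},p^{\mathrm{su}},p^{\mathrm{sd}},q^{\mathrm{tot}},q^{\mathrm{res}},u^{\mathrm{on}})-(\overline p^{\mathrm{tot}},\overline p^{\mathrm{su}},\overline p^{\mathrm{sd}},\overline q^{\mathrm{tot}},\overline q^{\mathrm{res}},\overline u^{\mathrm{on}})\|_\ell^\ell$ (restricted to the relevant entries when arguments carry subscripts). $\overline Z^{\mathrm T}_t(\overline p_t,\overline q_t,\overline u_t;\rho)$: maximize $\overline R^{\mathrm T}_t(p_t,q_t,u_t,\chi_t)-\rho\Gamma'_2(p_t,q_t,u_t,\overline p_t,\overline q_t,\overline u_t)-\rho\sum_{j\in\mathcal J^{\mathrm{sh}}}(\mu^{\mathrm{sh}}_{jt}-\overline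 u^{\mathrm{sh}}_{jt}\omega_{i_jt})^2$ subject to $(p_t,q_t,\mu_t,\omega_t)\in\mathcal X^{\mathrm{soc}}_t$ and $(p_{jt},q_{jt},u^{\mathrm{on}}_{jt},\chi_{jt})\in\overline{\mathcal Y}^{\mathrm{uc}}_{jt}$ for $j\in\mathcal J^{\mathrm{sd}}$, where $\overline R^{\mathrm T}_t=\sum_{j\in\mathcal J^{\mathrm{cs}}}R^{\mathrm{pow}}_{jt}-\sum_{j\in\mathcal J^{\mathrm{pr}}}C^{\mathrm{pow}}_{jt}-\sum_{j\in\mathcal J^{\mathrm{ac}}}C^{\mathrm{ac}}_{jt}-\sum_iC^{\mathrm{bal}}_{it}-C^{\mathrm{res}}_t-\sum_{j\in\mathcal J^{\mathrm{sd}}}\big(c^{\mathrm{on}}_{jt}u^{\mathrm{on}}_{jt}+(\max_{t'\in\mathcal T^{\mathrm{supc}}_{jt}}c^{\mathrm{on}}_{jt'}+c^{\mathrm{su}}_j)\chi^{\mathrm{su}}_{jt}+(\max_{t'\in\mathcal T^{\mathrm{sdpc}}_{jt}}c^{\mathrm{on}}_{j,t'-1}+c^{\mathrm{sd}}_j)\chi^{\mathrm{sd}}_{jt}\big)$ (with $c^{\mathrm{on}}_{j0}$ some given constant). $\overline Z^{\mathrm I}_i(p_i,q_i,u_i;\rho)$: maximize $\overline R^{\mathrm I}_i(\overline p_i,\overline q_i,\overline u_i;p_i,q_i)-\rho\Gamma'_1(p_i,q_i,u_i,\overline p_i,\overline q_i,\overline u_i)$ subject to $(\overline p_j,\overline q_j,\overline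 u_j)\in\mathcal X^{\mathrm{uc}}_j$ for all $j\in\mathcal J^{\mathrm{sd}}$ with $i_j=i$, where $\overline R^{\mathrm I}_i(\overline p,\overline q,\overline u;p,q)=\sum_{j\in\mathcal J^{\mathrm{sd}},i_j=i}\big(R^{\mathrm J}_j(\overline p,\overline u)-\sum_{t,r}d_tc^{\mathrm{res,p}}_{jtr}\overline p^{\mathrm{res}}_{jtr}-\sum_{t}\sum_{r\in\{\uparrow,\downarrow\}}d_tc^{\mathrm{res,q}}_{jtr}\overline q^{\mathrm{res}}_{jtr}\big)-\sum_t\overline C^{\mathrm{bal}}_{it}$, and $\overline C^{\mathrm{bal}}_{it}$ is $C^{\mathrm{bal}}_{it}$ evaluated with device injections from $(\overline p,\overline q)$ and branch and shunt flows fixed to those of $(p,q)$. $Z^{\mathrm{SH}}_{jt}(x)=\lfloor\frac12+\mathrm{proj}_{[u^{\mathrm{sh,min}}_j,u^{\mathrm{sh,max}}_j]}(x)\rfloor$. $H_j(\overline p_j,\overline u_j)$: maximize $\sum_t(\delta^-_{jt}+\delta^+_{jt})$ subject to, for all $t\in\mathcal T$ and with $\delta^\pm_{j0}=0$, $r^{\mathrm d}_{jt}=r^{\mathrm d}_{jt}(\overline u)$, $r^{\mathrm u}_{jt}=r^{\mathrm u}_{jt}(\overline u)$, $\eta_{jt}=\overline p^{\mathrm{tot}}_{jt}-\overline p^{\mathrm{tot}}_{j,t-1}$: $\delta^-_{jt}+\delta^+_{j,t-1}\le r^{\mathrm d}_{jt}+\eta_{jt}$; $\delta^-_{j,t-1}+\delta^+_{jt}\le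 r^{\mathrm u}_{jt}-\eta_{jt}$; $\delta^-_{jt}\ge\frac12\min\{r^{\mathrm d}_{jt}+\eta_{jt},\,r^{\mathrm u}_{j,t+1}-\eta_{j,t+1}\}$; $\delta^+_{jt}\ge\frac12\min\{r^{\mathrm u}_{jt}-\eta_{jt},\,r^{\mathrm d}_{j,t+1}+\eta_{j,t+1}\}$ (entries with index $T+1$ are omitted from the minima). $Z^{\mathrm F}_t(\overline p,\overline q,\overline u,\overline{\mathcal N};\delta)$: maximize $R^{\mathrm F}_t(p_t,q_t;\overline p)-\overline C^{\mathrm{ctg}}_t(p_t,q_t;\overline{\mathcal N})$ subject to (P1)–(P4) and (Q) at period $t$ for all $j\in\mathcal J^{\mathrm{sd}}$, $\overline p^{\mathrm{tot}}_{jt}-\delta^-_{jt}\le p^{\mathrm{tot}}_{jt}\le\overline p^{\mathrm{tot}}_{jt}+\delta^+_{jt}$ for all $j\in\mathcal J^{\mathrm{sd}}$, $(p_t,q_t,u^{\mathrm{sh}}_t)\in\mathcal X^{\mathrm{ac}}_t$, and $u=\overline u$ (all commitment and shunt variables fixed). For $\overline{\mathcal N}=\emptyset$ the term $\overline C^{\mathrm{ctg}}_t$ is absent. Here $R^{\mathrm F}_t=\sum_{j\in\mathcal J^{\mathrm{cs}}}R^{\mathrm{pow}}_{jt}-\sum_{j\in\mathcal J^{\mathrm{pr}}}C^{\mathrm{pow}}_{jt}-C^{\mathrm{res}}_t-\sum_{j\in\mathcal J^{\mathrm{ac}}}C^{\mathrm{ac}}_{jt}-\sum_iC^{\mathrm{bal}}_{it}-\sum_{j\in\mathcal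 J^{\mathrm{sd}}}\overline C^{\mathrm e}_{jt}(p;\overline p)$ with $\overline C^{\mathrm e}_{jt}(p;\overline p)=c^{\mathrm e}d_t\Big(\sum_{W\in\mathcal W^{\mathrm{en,min}}_j,W\ni t}\big[\tfrac{e^{\min}_j(W)-\sum_{t'\in W}d_{t'}\overline p^{\mathrm{tot}}_{jt'}}{\sum_{t'\in W}d_{t'}}+\overline p^{\mathrm{tot}}_{jt}-p^{\mathrm{tot}}_{jt}\big]^++\sum_{W\in\mathcal W^{\mathrm{en,max}}_j,W\ni t}\big[\tfrac{-e^{\max}_j(W)+\sum_{t'\in W}d_{t'}\overline p^{\mathrm{tot}}_{jt'}}{\sum_{t'\in W}d_{t'}}+p^{\mathrm{tot}}_{jt}-\overline p^{\mathrm{tot}}_{jt}\big]^+\Big)$. **Contingency screening** at $(\hat p,\hat q)$ with parameters $N^{\mathrm{ctg}},N^{\mathrm{br}},N^{\mathrm{bus}},s^{\mathrm{thr}}$ returns $\overline{\mathcal N}=(\overline{\mathcal I},\overline{\mathcal J},\overline{\mathcal K})$: $\overline{\mathcal K}$ consists of the $N^{\mathrm{ctg}}$ contingencies $k$ with largest $\max_t\max\{|\hat p^{\mathrm{fr}}_{j_kt}|,|\hat p^{\mathrm{to}}_{j_kt}|\}$; $\overline{\mathcal J}_{kt}$ consists of the (at most) $N^{\mathrm{br}}$ branches $j\in\mathcal J^{\mathrm{ac}}\setminus\{j_k\}$ with largest value of $\|(f_{kjt}(\hat p),\max\{|\hat q^{\mathrm{fr}}_{jt}|,|\hat q^{\mathrm{to}}_{jt}|\})\|_2-s^{\mathrm{max,ctg}}_j$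 among those for which it is $\ge s^{\mathrm{thr}}$; $\overline{\mathcal I}_{kjt}$ consists of the $N^{\mathrm{bus}}$ buses $i$ with largest $|h_{kjit}(\hat p)|$. Then $\overline C^{\mathrm{ctg}}_{kt}(p,q;\overline{\mathcal N})=c^{\mathrm s}d_t\sum_{j\in\overline{\mathcal J}_{kt}}\big[\|(\sum_{i\in\overline{\mathcal I}_{kjt}}h_{kjit}(p),\max\{|q^{\mathrm{fr}}_{jt}|,|q^{\mathrm{to}}_{jt}|\})\|_2-s^{\mathrm{max,ctg}}_j\big]^+$ and $\overline C^{\mathrm{ctg}}_t=\kappa_t\sum_{k\in\overline{\mathcal K}}\overline C^{\mathrm{ctg}}_{kt}+\max_{k\in\overline{\mathcal K}}\overline C^{\mathrm{ctg}}_{kt}$ with $\kappa_t=\frac{\sum_{k\in\overline{\mathcal K}}C^{\mathrm{ctg}}_{kt}(\hat p,\hat q)}{N^{\mathrm{ctg}}\sum_{k\in\overline{\mathcal K}}\overline C^{\mathrm{ctg}}_{kt}(\hat p,\hat q;\overline{\mathcal N})}$ (any fixed nonnegative value if the denominator vanishes). **Tailored penalty alternating direction method.** Input: penalties $\rho_1,\dots,\rho_{\overline\tau}>0$ and screening parameters. Every ''solve'' returns a feasible point of the subproblem. For $\tau=1,\dots,\overline\tau$: (i) for each $t$ solve $\overline Z^{\mathrm T}_t(0,0,0;0)$ if $\tau=1$, else $\overline Z^{\mathrm T}_t(\overline p^{(\tau-1)}_t,\overline q^{(\tau-1)}_t,\overline u^{(\tau-1)}_t;\rho_\tau)$, obtaining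 $(p^{(\tau)}_t,q^{(\tau)}_t,u^{(\tau)}_t,\chi^{(\tau)}_t,\mu^{(\tau)}_t,\omega^{(\tau)}_t)$; (ii) for each $i\in\mathcal I$ solve $\overline Z^{\mathrm I}_i(p^{(\tau)}_i,q^{(\tau)}_i,u^{(\tau)}_i;\rho_\tau)$, obtaining $(\overline p^{(\tau)}_i,\overline q^{(\tau)}_i,\overline u^{(\tau)}_i)$; (iii) set $\overline u^{\mathrm{sh}(\tau)}_{jt}=Z^{\mathrm{SH}}_{jt}(\mu^{\mathrm{sh}(\tau)}_{jt}/\omega^{(\tau)}_{i_jt})$. Afterwards: for each $j\in\mathcal J^{\mathrm{sd}}$ let $(\delta^-_j,\delta^+_j)$ be an optimal solution of $H_j(\overline p^{(\overline\tau)}_j,\overline u^{(\overline\tau)}_j)$; for each $t$ solve $Z^{\mathrm F}_t(\overline p^{(\overline\tau)},\overline q^{(\overline\tau)},\overline u^{(\overline\tau)},\emptyset;\delta)$, giving $(p^{\mathrm F}_t,q^{\mathrm F}_t,u^{\mathrm F}_t)$; run contingency screening at $(p^{\mathrm F},q^{\mathrm F})$ to get $\overline{\mathcal N}$; for each $t$ solve $Z^{\mathrm F}_t(\overline p^{(\overline\tau)},\overline q^{(\overline\tau)},\overline u^{(\overline\tau)},\overline{\mathcal N};\delta)$, giving $(p_t,q_t,u_t)$; return $(p,q,u)$.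
   Formalization: The integral shunt bounds u^{sh,min}, u^{sh,max} are taken to be nonnegative integers; with a negative lower bound the rounding Z^SH may return a negative step, which lies outside Z_+ and violates (F4). *)

(* Defs.v *)
From HB Require Import structures.
From mathcomp Require Import all_boot all_order all_algebra.
From mathcomp Require Import all_classical all_reals all_analysis.
Set Implicit Arguments.
Unset Strict Implicit.
Unset Printing Implicit Defensive.
Import Order.TTheory GRing.Theory Num.Theory numFieldNormedType.Exports.
Local Open Scope classical_set_scope.
Local Open Scope ring_scope.

(* The disjoint unions producers/consumers and AC/DC branches are sum types. *)
Record index_sets := IndexSets {
  nT : nat;
  Jpr : finType;
  Jcs : finType;
  bus : finType;
  Jac : finType;
  Jdc : finType;
  Jsh : finType;
  reserve : finType;
  nK : nat
}.

Definition Jsd (S : index_sets) : finType := (Jpr S + Jcs S)%type.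
Definition Jbr (S : index_sets) : finType := (Jac S + Jdc S)%type.

(* Periods are 0-based: the ordinal t stands for the period numbered t + 1.
   Values at the initial time 0 are separate data, see lag. *)
Notation period S := ('I_(nT S)).
Notation contingency S := ('I_(nK S)).

Notation direction := bool (only parsing).
Definition up : direction := true.
Definition down : direction := false.

Section Generic.
Variable R : realType.

Definition pos_part (x : R) : R := Num.max x 0.

Definition norm2 (a b : R) : R := Num.sqrt (a ^+ 2 + b ^+ 2).

(* Maximum of f over A, read as 0 when A is empty. *)
Definition fmax (X : finType) (A : {set X}) (f : X -> R) : R :=
  if [pick x in A] is Some x0 then \big[Num.max/f x0]_(x in A) f x else 0.

(* lag x0 x t is x_(t-1), with x_0 = x0 before the first period. *)
Definition lag (n : nat) (x0 : R) (x : 'I_n -> R) (t : 'I_n) : R :=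
  if t == 0%N :> nat then x0
  else x (Ordinal (leq_ltn_trans (leq_pred t) (ltn_ord t))).

(* min {a, f (t+1)}, the second entry being omitted when t is the last period. *)
Definition min_next (n : nat) (a : R) (f : 'I_n -> R) (t : 'I_n) : R :=
  if (insub t.+1 : option 'I_n) is Some s then Num.min a (f s) else a.

Definition polyhedral (m n : nat) (X : set 'M[R]_(m, n)) : Prop :=
  exists (l : nat) (A : 'I_l -> 'M[R]_(m, n)) (b : 'I_l -> R),
    X = [set x | forall k, \sum_i \sum_j A k i j * x i j <= b k].

(* Affine between consecutive breakpoints, for some finite list s of them. *)
Definition piecewise_linear (f : R -> R) : Prop :=
  exists s : seq R, forall a b : R, a < b ->
    (forall x, x \in s -> ~~ (a < x < b)) ->
    exists m c : R, forall x, a <= x <= b -> f x = m * x + c.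

Definition convex_pwl (f : R -> R) : Prop :=
  piecewise_linear f /\ convex_function (E := R^o) setT (f : R^o -> R^o).

Definition concave_pwl (f : R -> R) : Prop :=
  piecewise_linear f /\
  convex_function (E := R^o) setT ((fun x => - f x) : R^o -> R^o).

Definition is_binary (x : R) : Prop := x = 0 \/ x = 1.

(* B consists of the n elements of A with the largest values of f (all of A if
   it has fewer than n elements); ties are broken arbitrarily. *)
Definition is_top (X : finType) (n : nat) (A : {set X}) (f : X -> R)
    (B : {set X}) : Prop :=
  [/\ B \subset A, #|B| = minn n #|A| &
      forall x y, x \in B -> y \in A :\: B -> f y <= f x].

Record problem (X : Type) := Problem {
  feasible : set X;
  objective : X -> R
}.

Definition optimal_value (X : Type) (P : problem X) : \bar R :=
  ereal_sup [set (objective P x)%:E | x in feasible P].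

Definition optimal (X : Type) (P : problem X) (x : X) : Prop :=
  feasible P x /\ forall y, feasible P y -> objective P y <= objective P x.

(* A solve is only required to return a feasible point of the subproblem. *)
Definition solve (X : Type) (P : problem X) (x : X) : Prop := feasible P x.

Inductive requirement := ReqConst of R | ReqSum of R | ReqMax of R.

Definition requirement_ok (rq : requirement) : Prop :=
  match rq with
  | ReqConst _ => True
  | ReqSum a | ReqMax a => 0 <= a
  end.

Definition requirement_val (X : finType) (rq : requirement) (x : X -> R)
    (N : {set X}) : R :=
  match rq with
  | ReqConst a => a
  | ReqSum a => a * \sum_(j in N) x j
  | ReqMax a => a * fmax N x
  end.

End Generic.

Section Data.
Variables (R : realType) (S : index_sets).

Record dev_p := DevP { ptot : R; pon : R; psu : R; psd : R;
                       pres : reserve S -> R }.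
Record dev_q := DevQ { qtot : R; qres : direction -> R }.
Record dev_u := DevU { uon : R; usu : R; usd : R }.

(* Used both for real and for reactive power. *)
Record flows := Flows { xsh : Jsh S -> R; xfr : Jbr S -> R; xto : Jbr S -> R }.

(* The collections p_t, q_t, u_t; a full collection p, q or u is a function of
   the period. *)
Record per_p := PerP { pdev : Jsd S -> dev_p; pflow : flows }.
Record per_q := PerQ { qdev : Jsd S -> dev_q; qflow : flows }.
Record per_u := PerU { udev : Jsd S -> dev_u; ush : Jsh S -> R }.

(* (v, Delta, theta, tau, phi) in one period; tap is the tap ratio tau. *)
Record ac_state := AcState { vmag : bus S -> R; adiff : Jac S -> R;
  theta : bus S -> R; tap : Jac S -> R; phi : Jac S -> R }.

Definition zero_p (_ : Jsd S) : dev_p := DevP 0 0 0 0 (fun=> 0).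
Definition zero_q (_ : Jsd S) : dev_q := DevQ 0 (fun=> 0).
Definition zero_u : per_u := PerU (fun=> DevU 0 0 0) (fun=> 0).

(* (u^on_t, u^su_t, u^sd_t)_t as a 3 x T matrix. *)
Definition commitment_mx (u : period S -> dev_u) : 'M[R]_(3, nT S) :=
  \matrix_(k, t) [:: uon (u t); usu (u t); usd (u t)]`_k.

(* (u^on, p^tot, p^on, (p^res_r)_r) as a vector. *)
Definition power_vec (on : R) (x : dev_p) : 'rV[R]_(3 + #|reserve S|) :=
  row_mx (\row_k [:: on; ptot x; pon x]`_k) (\row_k pres x (enum_val k)).

Record scuc_data := ScucData {
  dur : period S -> R;
  dur_gt0 : forall t, 0 < dur t;

  dev_bus : Jsd S -> bus S;
  sh_bus : Jsh S -> bus S;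
  fr_bus : Jbr S -> bus S;
  to_bus : Jbr S -> bus S;

  uon0 : Jsd S -> R;
  uon0_bin : forall j, is_binary (uon0 j);
  ptot0 : Jsd S -> R;
  psupc : Jsd S -> period S -> period S -> R;
  psupc_ge0 : forall j t t', 0 <= psupc j t t';
  psdpc : Jsd S -> period S -> period S -> R;
  psdpc_ge0 : forall j t t', 0 <= psdpc j t t';
  Xu : Jsd S -> set 'M[R]_(3, nT S);
  Xu_poly : forall j, polyhedral (Xu j);
  Xp : Jsd S -> period S -> set 'rV[R]_(3 + #|reserve S|);
  Xp_poly : forall j t, polyhedral (Xp j t);
  qmax : Jsd S -> period S -> R;
  qmin : Jsd S -> period S -> R;
  betamax : Jsd S -> R;
  betamin : Jsd S -> R;
  pru : Jsd S -> R;
  prd : Jsd S -> R;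
  prusu : Jsd S -> R;
  prdsd : Jsd S -> R;

  (* gfr j, gto j, gbr j are g_{i_j j}, g_{i'_j j}, g_j; likewise for b. *)
  gfr : Jac S -> R;
  gto : Jac S -> R;
  gbr : Jac S -> R;
  bfr : Jac S -> R;
  bto : Jac S -> R;
  bbr : Jac S -> R;
  gsh : Jsh S -> R;
  bsh : Jsh S -> R;
  vmin : bus S -> R;
  vmax : bus S -> R;
  vmin_gt0 : forall i, 0 < vmin i;
  vmax_gt0 : forall i, 0 < vmax i;
  phimin : Jac S -> R;
  phimax : Jac S -> R;
  tapmin : Jac S -> R;
  tapmax : Jac S -> R;
  tapmin_gt0 : forall j, 0 < tapmin j;
  tapmax_gt0 : forall j, 0 < tapmax j;
  pdcmax : Jdc S -> R;
  qfrmin : Jdc S -> R;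
  qfrmax : Jdc S -> R;
  qtomin : Jdc S -> R;
  qtomax : Jdc S -> R;
  (* The integral bounds on the number of active shunt steps lie in Z_+. *)
  ushmin : Jsh S -> nat;
  ushmax : Jsh S -> nat;

  con : Jsd S -> period S -> R;
  con0 : Jsd S -> R;
  csu : Jsd S -> R;
  csu_ge0 : forall j, 0 <= csu j;
  csd : Jsd S -> R;
  csd_ge0 : forall j, 0 <= csd j;
  cdd : Jsd S -> period S -> period S -> R;
  cdd_ge0 : forall j t t', 0 <= cdd j t t';
  ce : R;
  ce_ge0 : 0 <= ce;
  Wmin : Jsd S -> {set {set period S}};
  Wmin_neq0 : forall j, finset.set0 \notin Wmin j;
  Wmax : Jsd S -> {set {set period S}};
  Wmax_neq0 : forall j, finset.set0 \notin Wmax j;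
  emin : Jsd S -> {set period S} -> R;
  emax : Jsd S -> {set period S} -> R;
  Cpow : Jpr S -> period S -> R -> R;
  Cpow_convex : forall j t, convex_pwl (Cpow j t);
  Rpow : Jcs S -> period S -> R -> R;
  Rpow_concave : forall j t, concave_pwl (Rpow j t);
  cresp : Jsd S -> period S -> reserve S -> R;
  cresp_ge0 : forall j t r, 0 <= cresp j t r;
  cresq : Jsd S -> period S -> direction -> R;
  cresq_ge0 : forall j t r, 0 <= cresq j t r;
  cresP : {set reserve S} -> R;
  cresP_ge0 : forall R', 0 <= cresP R';
  cresQ : direction -> R;
  cresQ_ge0 : forall r, 0 <= cresQ r;
  Np : {set {set Jsd S}};
  Nq : {set {set Jsd S}};
  reqp : period S -> {set reserve S} -> {set Jsd S} -> requirement R;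
  reqp_ok : forall t R' N, requirement_ok (reqp t R' N);
  reqq : period S -> direction -> {set Jsd S} -> requirement R;
  reqq_ok : forall t r N, requirement_ok (reqq t r N);
  cs : R;
  cs_ge0 : 0 <= cs;
  smax : Jac S -> R;
  smaxctg : Jac S -> R;
  cp : R;
  cp_ge0 : 0 <= cp;
  cq : R;
  cq_ge0 : 0 <= cq;
  jctg : contingency S -> Jac S;
  ptdf : contingency S -> Jac S -> bus S -> R
}.

End Data.

Section Model.
Variables (R : realType) (S : index_sets) (D : scuc_data R S).
Local Notation period := (period S).
Local Notation dev_p := (dev_p R S).
Local Notation dev_q := (dev_q R).
Local Notation dev_u := (dev_u R).
Local Notation flows := (flows R S).
Local Notation per_p := (per_p R S).
Local Notation per_q := (per_q R S).
Local Notation per_u := (per_u R S).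
Local Notation ac_state := (ac_state R S).

Definition Tsupc (j : Jsd S) (t : period) : {set period} :=
  [set t' : period | (t < t')%N && (0 < psupc D j t t')].

Definition Tsdpc (j : Jsd S) (t : period) : {set period} :=
  [set t' : period | (t' <= t)%N && (0 < psdpc D j t t')].

Definition constr_U (j : Jsd S) (u : period -> dev_u) : Prop :=
  [/\ forall t, uon (u t) - lag (uon0 D j) (fun s => uon (u s)) t
                = usu (u t) - usd (u t),
      forall t, usu (u t) + usd (u t) <= 1,
      Xu D j (commitment_mx u) &
      forall t, [/\ is_binary (uon (u t)), is_binary (usu (u t)) &
                    is_binary (usd (u t))]].

Definition constr_P1 (x : dev_p) : Prop := ptot x = pon x + psu x + psd x.

Definition constr_P2 (j : Jsd S) (t : period) (u : period -> dev_u)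
    (x : dev_p) : Prop :=
  psu x = \sum_(t' in Tsupc j t) psupc D j t t' * usu (u t') /\
  psd x = \sum_(t' in Tsdpc j t) psdpc D j t t' * usd (u t').

Definition constr_P3 (j : Jsd S) (t : period) (on : R) (x : dev_p) : Prop :=
  Xp D j t (power_vec on x).

Definition constr_P4 (x : dev_p) : Prop :=
  [/\ 0 <= ptot x, 0 <= pon x & forall r, 0 <= pres x r].

Definition sigma (j : Jsd S) (t : period) (u : period -> dev_u) : R :=
  uon (u t) + \sum_(t' in Tsupc j t) usu (u t')
            + \sum_(t' in Tsdpc j t) usd (u t').

(* The directions (a, b) of the reactive reserve entering (Q). *)
Definition qdir_max (j : Jsd S) : direction :=
  match j with inl _ => up | inr _ => down end.
Definition qdir_min (j : Jsd S) : direction :=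
  match j with inl _ => down | inr _ => up end.

Definition constr_Q (j : Jsd S) (t : period) (sg : R) (x : dev_p) (y : dev_q)
    : Prop :=
  [/\ qtot y <= qmax D j t * sg + betamax D j * ptot x - qres y (qdir_max j),
      qmin D j t * sg + betamin D j * ptot x + qres y (qdir_min j) <= qtot y &
      forall r, 0 <= qres y r].

Definition ramp_down (j : Jsd S) (t : period) (u : dev_u) : R :=
  dur D t * (prd D j * uon u + prdsd D j * (1 - uon u)).

Definition ramp_up (j : Jsd S) (t : period) (u : dev_u) : R :=
  dur D t * (pru D j * (uon u - usu u) + prusu D j * (usu u - uon u + 1)).

Definition ptot_incr (j : Jsd S) (p : period -> dev_p) (t : period) : R :=
  ptot (p t) - lag (ptot0 D j) (fun s => ptot (p s)) t.

Definition constr_R (j : Jsd S) (t : period) (p : period -> dev_p)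
    (u : period -> dev_u) : Prop :=
  - ramp_down j t (u t) <= ptot_incr j p t <= ramp_up j t (u t).

Definition X_uc (j : Jsd S) (p : period -> dev_p) (q : period -> dev_q)
    (u : period -> dev_u) : Prop :=
  constr_U j u /\
  forall t, [/\ constr_P1 (p t), constr_P2 j t u (p t),
                constr_P3 j t (uon (u t)) (p t) & constr_P4 (p t)] /\
            (constr_Q j t (sigma j t u) (p t) (q t) /\ constr_R j t p u).

Definition constr_F1 (p q : flows) (w : ac_state) : Prop :=
  forall j : Jac S,
    let i := fr_bus D (inl j) in let i' := to_bus D (inl j) in
    let v := vmag w in let dl := adiff w j in let tp := tap w j in
    [/\ dl = theta w i - theta w i' - phi w j,
        xfr p (inl j) = v i * (gfr D j * v i / tp ^+ 2
          + v i' / tp * (- gbr D j * cos dl - bbr D j * sin dl)),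
        xto p (inl j) = v i' * (gto D j * v i'
          + v i / tp * (- gbr D j * cos dl + bbr D j * sin dl)),
        xfr q (inl j) = v i * (- bfr D j * v i / tp ^+ 2
          + v i' / tp * (bbr D j * cos dl - gbr D j * sin dl)) &
        xto q (inl j) = v i' * (- bto D j * v i'
          + v i / tp * (bbr D j * cos dl + gbr D j * sin dl))].

Definition constr_dc_balance (p : flows) : Prop :=
  forall j : Jdc S, xfr p (inr j) + xto p (inr j) = 0.

Definition constr_F2 (p q : flows) (us : Jsh S -> R) (w : ac_state) : Prop :=
  constr_dc_balance p /\
  forall j : Jsh S,
    xsh p j = gsh D j * us j * vmag w (sh_bus D j) ^+ 2 /\
    xsh q j = - bsh D j * us j * vmag w (sh_bus D j) ^+ 2.

Definition constr_DC (p q : flows) : Prop :=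
  forall j : Jdc S,
    [/\ - pdcmax D j <= xfr p (inr j) <= pdcmax D j,
        - pdcmax D j <= xto p (inr j) <= pdcmax D j,
        qfrmin D j <= xfr q (inr j) <= qfrmax D j &
        qtomin D j <= xto q (inr j) <= qtomax D j].

Definition constr_F3 (p q : flows) (w : ac_state) : Prop :=
  [/\ forall i, vmin D i <= vmag w i <= vmax D i,
      forall j, phimin D j <= phi w j <= phimax D j,
      forall j, tapmin D j <= tap w j <= tapmax D j &
      constr_DC p q].

Definition constr_F4 (us : Jsh S -> R) : Prop :=
  forall j, ((ushmin D j)%:R <= us j <= (ushmax D j)%:R) /\
            us j \is a Num.nat.

Definition X_ac (p q : flows) (us : Jsh S -> R) : Prop :=
  exists w : ac_state,
    [/\ constr_F1 p q w, constr_F2 p q us w & constr_F3 p q w].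

Definition C_uc (j : Jsd S) (u : period -> dev_u) : R :=
  \sum_t (con D j t * uon (u t) + csu D j * usu (u t) + csd D j * usd (u t)
    - \sum_(t' < nT S | (t' < t)%N)
        cdd D j t t' * pos_part (usu (u t) + uon (u t') - 1)).

Definition window_energy (W : {set period}) (p : period -> dev_p) : R :=
  \sum_(t in W) dur D t * ptot (p t).

Definition C_e (j : Jsd S) (p : period -> dev_p) : R :=
  ce D * (\sum_(W in Wmin D j) pos_part (emin D j W - window_energy W p)
        + \sum_(W in Wmax D j) pos_part (- emax D j W + window_energy W p)).

Definition C_res (t : period) (p : Jsd S -> dev_p) (q : Jsd S -> dev_q) : R :=
  dur D t *
  (\sum_j \sum_r cresp D j t r * pres (p j) r
   + \sum_(R' : {set reserve S}) cresP D R' * \sum_(N in Np D)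
       pos_part (requirement_val (reqp D t R' N) (fun j => ptot (p j)) N
                 - \sum_(r in R') \sum_(j in N) pres (p j) r)
   + \sum_(r : direction)
       (\sum_j cresq D j t r * qres (q j) r
        + cresQ D r * \sum_(N in Nq D)
            pos_part (requirement_val (reqq D t r N) (fun j => qtot (q j)) N
                      - \sum_(j in N) qres (q j) r))).

Definition C_ac (j : Jac S) (t : period) (p q : flows) : R :=
  cs D * dur D t *
  pos_part (Num.max (norm2 (xfr p (inl j)) (xfr q (inl j)))
                    (norm2 (xto p (inl j)) (xto q (inl j))) - smax D j).

(* xtot is the family of device injections p^tot_t or q^tot_t. *)
Definition device_balance (i : bus S) (xtot : Jsd S -> R) : R :=
  \sum_(j : Jpr S | dev_bus D (inl j) == i) xtot (inl j)
  - \sum_(j : Jcs S | dev_bus D (inr j) == i) xtot (inr j).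

Definition balance (i : bus S) (xtot : Jsd S -> R) (x : flows) : R :=
  device_balance i xtot
  - \sum_(j | sh_bus D j == i) xsh x j
  - \sum_(j | fr_bus D j == i) xfr x j
  - \sum_(j | to_bus D j == i) xto x j.

Definition C_bal (i : bus S) (t : period) (ptot_ : Jsd S -> R) (p : flows)
    (qtot_ : Jsd S -> R) (q : flows) : R :=
  dur D t * (cp D * `|balance i ptot_ p| + cq D * `|balance i qtot_ q|).

Definition C_bal_at (i : bus S) (t : period) (p : per_p) (q : per_q) : R :=
  C_bal i t (fun j => ptot (pdev p j)) (pflow p)
            (fun j => qtot (qdev q j)) (qflow q).

Definition p_inj (i : bus S) (p : per_p) : R :=
  device_balance i (fun j => ptot (pdev p j))
  - \sum_(j | sh_bus D j == i) xsh (pflow p) j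
  - \sum_(j : Jdc S | fr_bus D (inr j) == i) xfr (pflow p) (inr j)
  - \sum_(j : Jdc S | to_bus D (inr j) == i) xto (pflow p) (inr j).

Definition flow_part (k : contingency S) (j : Jac S) (i : bus S) (p : per_p)
    : R :=
  ptdf D k j i * (p_inj i p - #|bus S|%:R^-1 * \sum_(i' : bus S) p_inj i' p).

(* Excess of the apparent post-contingency flow on j over its limit; only the
   buses in A contribute to the real flow. *)
Definition ctg_excess (A : {set bus S}) (k : contingency S) (j : Jac S)
    (p : per_p) (q : per_q) : R :=
  norm2 (\sum_(i in A) flow_part k j i p)
        (Num.max `|xfr (qflow q) (inl j)| `|xto (qflow q) (inl j)|)
  - smaxctg D j.

Definition C_ctg_k (k : contingency S) (t : period) (p : per_p) (q : per_q)
    : R :=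
  cs D * dur D t *
  \sum_(j | j != jctg D k) pos_part (ctg_excess [set: bus S]%SET k j p q).

Definition C_ctg (t : period) (p : per_p) (q : per_q) : R :=
  (nK S)%:R^-1 * \sum_(k < nK S) C_ctg_k k t p q
  + fmax [set: contingency S]%SET (fun k => C_ctg_k k t p q).

Definition R_T (t : period) (p : per_p) (q : per_q) : R :=
  - C_res t (pdev p) (qdev q) - C_ctg t p q
  - \sum_j C_ac j t (pflow p) (qflow q) - \sum_i C_bal_at i t p q.

Definition R_J (j : Jsd S) (p : period -> dev_p) (u : period -> dev_u) : R :=
  - C_uc j u - C_e j p +
  match j with
  | inl j' => - \sum_t Cpow D j' t (ptot (p t))
  | inr j' => \sum_t Rpow D j' t (ptot (p t))
  end.

Definition scuc_point : Type :=
  ((period -> per_p) * (period -> per_q) * (period -> per_u)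
   * (period -> ac_state))%type.

Definition scuc_acopf : problem R scuc_point := {|
  feasible := [set x : scuc_point | let: (p, q, u, w) := x in
    (forall j, X_uc j (fun t => pdev (p t) j) (fun t => qdev (q t) j)
                      (fun t => udev (u t) j)) /\
    (forall t, [/\ constr_F1 (pflow (p t)) (qflow (q t)) (w t),
                   constr_F2 (pflow (p t)) (qflow (q t)) (ush (u t)) (w t),
                   constr_F3 (pflow (p t)) (qflow (q t)) (w t) &
                   constr_F4 (ush (u t))])];
  objective := fun x => let: (p, q, u, w) := x in
    \sum_t R_T t (p t) (q t)
    + \sum_j R_J j (fun t => pdev (p t) j) (fun t => udev (u t) j)
|}.

Definition standing_assumption : Prop :=
  [/\ forall j (t : period),
        \sum_(t' < nT S | (t' < t)%N) cdd D j t t' <= csu D j,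
      forall j (u : period -> dev_u), constr_U j u -> forall t,
        uon (u t) + \sum_(t' in Tsupc j t) usu (u t') <= 1 /\
        uon (u t) + \sum_(t' in Tsdpc j t) usd (u t') <= 1,
      forall j t, [/\ closed (Xp D j t),
                      convex_set (M := 'rV[R]_(3 + #|reserve S|)) (Xp D j t),
                      bounded_set (Xp D j t) & polyhedral (Xp D j t)] &
      feasible scuc_acopf !=set0 /\ (0 <= optimal_value scuc_acopf)%E].

(* The variables (p_t, q_t, u_t, chi_t, mu_t, omega_t); u_t consists of u^on_t
   only. *)
Record zt_var := ZtVar {
  zp : per_p;
  zq : per_q;
  zon : Jsd S -> R;
  chisu : Jsd S -> R;
  chisd : Jsd S -> R;
  mu : Jac S -> R;
  mush : Jsh S -> R;
  omega : bus S -> R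
}.

Definition X_soc (p q : flows) (m : Jac S -> R) (msh : Jsh S -> R)
    (om : bus S -> R) : Prop :=
  exists c s : Jac S -> R,
  [/\ forall j : Jac S,
        let i := fr_bus D (inl j) in let i' := to_bus D (inl j) in
        [/\ xfr p (inl j) = gfr D j * m j - gbr D j * c j - bbr D j * s j,
            xto p (inl j) = gto D j * om i' - gbr D j * c j + bbr D j * s j,
            xfr q (inl j) = - bfr D j * m j + bbr D j * c j - gbr D j * s j &
            xto q (inl j) = - bto D j * om i' + bbr D j * c j + gbr D j * s j]
        /\ (c j ^+ 2 + s j ^+ 2 <= m j * om i' /\
            om i / tapmax D j ^+ 2 <= m j <= om i / tapmin D j ^+ 2),
      forall j : Jsh S,
        [/\ xsh p j = gsh D j * msh j, xsh q j = - bsh D j * msh j &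
            (ushmin D j)%:R * om (sh_bus D j) <= msh j
              <= (ushmax D j)%:R * om (sh_bus D j)],
      forall i, vmin D i ^+ 2 <= om i <= vmax D i ^+ 2,
      constr_dc_balance p &
      constr_DC p q].

Definition Y_uc (j : Jsd S) (t : period) (x : dev_p) (y : dev_q)
    (on xsu xsd : R) : Prop :=
  [/\ [/\ constr_P1 x, constr_P3 j t on x & constr_P4 x],
      0 <= psu x <= xsu * fmax (Tsupc j t) (psupc D j t) /\
      0 <= psd x <= xsd * fmax (Tsdpc j t) (psdpc D j t),
      constr_Q j t (on + xsu + xsd) x y,
      [/\ on + xsu <= 1, on + xsd <= 1, 0 <= on <= 1, 0 <= xsu <= 1 &
          0 <= xsd <= 1] &
      (Tsupc j t = finset.set0 -> xsu = 0) /\ (Tsdpc j t = finset.set0 -> xsd = 0)].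

(* Contribution of one device in one period to Gamma'_l. *)
Definition gamma_dev (l : nat) (x : dev_p) (y : dev_q) (on : R)
    (x' : dev_p) (y' : dev_q) (on' : R) : R :=
  `|ptot x - ptot x'| ^+ l + `|psu x - psu x'| ^+ l + `|psd x - psd x'| ^+ l
  + `|qtot y - qtot y'| ^+ l
  + \sum_(r : direction) `|qres y r - qres y' r| ^+ l
  + `|on - on'| ^+ l.

Definition Rbar_T (t : period) (x : zt_var) : R :=
  let P j := ptot (pdev (zp x) j) in
  \sum_(j : Jcs S) Rpow D j t (P (inr j))
  - \sum_(j : Jpr S) Cpow D j t (P (inl j))
  - \sum_j C_ac j t (pflow (zp x)) (qflow (zq x))
  - \sum_i C_bal_at i t (zp x) (zq x)
  - C_res t (pdev (zp x)) (qdev (zq x))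
  - \sum_j (con D j t * zon x j
            + (fmax (Tsupc j t) (con D j) + csu D j) * chisu x j
            + (fmax (Tsdpc j t) (lag (con0 D j) (con D j)) + csd D j)
              * chisd x j).

Definition Zbar_T (t : period) (pb : Jsd S -> dev_p) (qb : Jsd S -> dev_q)
    (ub : per_u) (rho : R) : problem R zt_var := {|
  feasible := [set x |
    X_soc (pflow (zp x)) (qflow (zq x)) (mu x) (mush x) (omega x) /\
    forall j, Y_uc j t (pdev (zp x) j) (qdev (zq x) j)
                   (zon x j) (chisu x j) (chisd x j)];
  objective := fun x =>
    Rbar_T t x
    - rho * \sum_j gamma_dev 2 (pdev (zp x) j) (qdev (zq x) j) (zon x j)
                               (pb j) (qb j) (uon (udev ub j))
    - rho * \sum_j (mush x j - ush ub j * omega x (sh_bus D j)) ^+ 2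
|}.

(* The device variables (pbar, qbar, ubar). The subproblem at bus i only
   involves the entries of the devices located at i, so that a family of
   solutions indexed by the buses is a single such triple. *)
Definition zi_var : Type :=
  ((period -> Jsd S -> dev_p) * (period -> Jsd S -> dev_q)
   * (period -> Jsd S -> dev_u))%type.

Definition Rbar_I (i : bus S) (pb : period -> Jsd S -> dev_p)
    (qb : period -> Jsd S -> dev_q) (ub : period -> Jsd S -> dev_u)
    (p : period -> per_p) (q : period -> per_q) : R :=
  \sum_(j | dev_bus D j == i)
    (R_J j (fun t => pb t j) (fun t => ub t j)
     - \sum_t \sum_r dur D t * cresp D j t r * pres (pb t j) r
     - \sum_t \sum_(r : direction) dur D t * cresq D j t r * qres (qb t j) r)
  - \sum_t C_bal i t (fun j => ptot (pb t j)) (pflow (p t))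
                     (fun j => qtot (qb t j)) (qflow (q t)).

Definition Zbar_I (i : bus S) (p : period -> per_p) (q : period -> per_q)
    (on : period -> Jsd S -> R) (rho : R) : problem R zi_var := {|
  feasible := [set x : zi_var | let: (pb, qb, ub) := x in
    forall j, dev_bus D j = i ->
      X_uc j (fun t => pb t j) (fun t => qb t j) (fun t => ub t j)];
  objective := fun x => let: (pb, qb, ub) := x in
    Rbar_I i pb qb ub p q
    - rho * \sum_(j | dev_bus D j == i) \sum_t
        gamma_dev 1 (pdev (p t) j) (qdev (q t) j) (on t j)
                    (pb t j) (qb t j) (uon (ub t j))
|}.

Definition Z_SH (j : Jsh S) (x : R) : R :=
  (Num.floor (2^-1 + Num.max (ushmin D j)%:R (Num.min x (ushmax D j)%:R)))%:~R.

Definition H (j : Jsd S) (p : period -> dev_p) (u : period -> dev_u)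
    : problem R ((period -> R) * (period -> R)) :=
  let rd t := ramp_down j t (u t) in
  let ru t := ramp_up j t (u t) in
  let eta := ptot_incr j p in {|
  feasible := [set x : (period -> R) * (period -> R) | let: (dm, dp) := x in
    forall t,
    [/\ dm t + lag 0 dp t <= rd t + eta t,
        lag 0 dm t + dp t <= ru t - eta t,
        2^-1 * min_next (rd t + eta t) (fun s => ru s - eta s) t <= dm t &
        2^-1 * min_next (ru t - eta t) (fun s => rd s + eta s) t <= dp t]];
  objective := fun x => \sum_t (x.1 t + x.2 t)
|}.

(* The weights kappa_t are part of the outcome because they are arbitrary
   nonnegative values when their defining quotient has denominator 0. *)
Record screening := Screening {
  Kbar : {set contingency S};
  Jbar : contingency S -> period -> {set Jac S};
  Ibar : contingency S -> Jac S -> period -> {set bus S};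
  kappa : period -> R
}.

Definition Cbar_ctg_k (sc : screening) (k : contingency S) (t : period)
    (p : per_p) (q : per_q) : R :=
  cs D * dur D t *
  \sum_(j in Jbar sc k t) pos_part (ctg_excess (Ibar sc k j t) k j p q).

Definition Cbar_ctg (sc : screening) (t : period) (p : per_p) (q : per_q) : R :=
  kappa sc t * \sum_(k in Kbar sc) Cbar_ctg_k sc k t p q
  + fmax (Kbar sc) (fun k => Cbar_ctg_k sc k t p q).

Definition is_screening (Nctg Nbr Nbus : nat) (sthr : R)
    (p : period -> per_p) (q : period -> per_q) (sc : screening) : Prop :=
  [/\ is_top Nctg [set: contingency S]%SET
        (fun k => fmax [set: period]%SET (fun t =>
           Num.max `|xfr (pflow (p t)) (inl (jctg D k))|
                   `|xto (pflow (p t)) (inl (jctg D k))|)) (Kbar sc),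
      forall k t, k \in Kbar sc ->
        let excess j := ctg_excess [set: bus S]%SET k j (p t) (q t) in
        is_top Nbr [set j | (j != jctg D k) && (sthr <= excess j)]%SET excess
               (Jbar sc k t),
      forall k t j, k \in Kbar sc -> j \in Jbar sc k t ->
        is_top Nbus [set: bus S]%SET (fun i => `|flow_part k j i (p t)|)
               (Ibar sc k j t) &
      forall t,
        let den := Nctg%:R *
          \sum_(k in Kbar sc) Cbar_ctg_k sc k t (p t) (q t) in
        (den = 0 -> 0 <= kappa sc t) /\
        (den != 0 ->
         kappa sc t = (\sum_(k in Kbar sc) C_ctg_k k t (p t) (q t)) / den)].

Definition Cbar_e (j : Jsd S) (t : period) (x : dev_p) (pb : period -> dev_p)
    : R :=
  let len W := \sum_(t' in W) dur D t' in
  ce D * dur D t *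
  (\sum_(W in Wmin D j | t \in W)
     pos_part ((emin D j W - window_energy W pb) / len W
               + ptot (pb t) - ptot x)
   + \sum_(W in Wmax D j | t \in W)
     pos_part ((- emax D j W + window_energy W pb) / len W
               + ptot x - ptot (pb t))).

Definition R_F (t : period) (p : per_p) (q : per_q)
    (pb : period -> Jsd S -> dev_p) : R :=
  let P j := ptot (pdev p j) in
  \sum_(j : Jcs S) Rpow D j t (P (inr j))
  - \sum_(j : Jpr S) Cpow D j t (P (inl j))
  - C_res t (pdev p) (qdev q)
  - \sum_j C_ac j t (pflow p) (qflow q)
  - \sum_i C_bal_at i t p q
  - \sum_j Cbar_e j t (pdev p j) (fun s => pb s j).

(* The variables are (p_t, q_t, u_t). The commitment variables of all periods
   are fixed to ubar, whence its occurrence in (P2) and (Q). The argument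
   osc = None encodes an empty screening outcome. *)
Definition Z_F (t : period) (pb : period -> Jsd S -> dev_p)
    (ub : period -> per_u) (osc : option screening)
    (dm dp : Jsd S -> period -> R) : problem R (per_p * per_q * per_u) := {|
  feasible := [set x : per_p * per_q * per_u | let: (p, q, u) := x in
    [/\ forall j, let ubj s := udev (ub s) j in
          [/\ constr_P1 (pdev p j), constr_P2 j t ubj (pdev p j),
              constr_P3 j t (uon (udev u j)) (pdev p j),
              constr_P4 (pdev p j) &
              constr_Q j t (sigma j t ubj) (pdev p j) (qdev q j)],
        forall j, ptot (pb t j) - dm j t <= ptot (pdev p j)
                    <= ptot (pb t j) + dp j t,
        X_ac (pflow p) (qflow q) (ush u) &
        u = ub t]];
  objective := fun x => let: (p, q, u) := x in
    R_F t p q pb - (if osc is Some sc then Cbar_ctg sc t p q else 0)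
|}.

Record padm_params := PadmParams {
  nIter : nat;
  nIter_gt0 : (0 < nIter)%N;
  rho : nat -> R;
  rho_gt0 : forall k, (1 <= k <= nIter)%N -> 0 < rho k;
  Nctg : nat;
  Nbr : nat;
  Nbus : nat;
  sthr : R
}.

(* The iterates of a run; zt, pbar, qbar, ubar are indexed by the iteration
   number in 1, ..., nIter. *)
Record padm_run := PadmRun {
  zt : nat -> period -> zt_var;
  pbar : nat -> period -> Jsd S -> dev_p;
  qbar : nat -> period -> Jsd S -> dev_q;
  ubar : nat -> period -> per_u;
  deltam : Jsd S -> period -> R;
  deltap : Jsd S -> period -> R;
  zF : period -> per_p * per_q * per_u;
  scr : screening;
  zfinal : period -> per_p * per_q * per_u
}.

Definition valid_iteration (par : padm_params) (r : padm_run) (k : nat)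
    : Prop :=
  [/\ forall t,
        solve (if k == 1%N then Zbar_T t (@zero_p R S) (@zero_q R S)
                                       (zero_u R S) 0
               else Zbar_T t (pbar r k.-1 t) (qbar r k.-1 t) (ubar r k.-1 t)
                           (rho par k))
              (zt r k t),
      forall i,
        solve (Zbar_I i (fun t => zp (zt r k t)) (fun t => zq (zt r k t))
                      (fun t => zon (zt r k t)) (rho par k))
              (pbar r k, qbar r k, fun t => udev (ubar r k t)) &
      forall j t,
        ush (ubar r k t) j
        = Z_SH j (mush (zt r k t) j / omega (zt r k t) (sh_bus D j))].

Definition valid_run (par : padm_params) (r : padm_run) : Prop :=
  let n := nIter par in
  [/\ forall k, (1 <= k <= n)%N -> valid_iteration par r k,
      forall j, optimal (H j (fun t => pbar r n t j)
                           (fun t => udev (ubar r n t) j))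
                        (deltam r j, deltap r j),
      forall t, solve (Z_F t (pbar r n) (ubar r n) None (deltam r) (deltap r))
                      (zF r t),
      is_screening (Nctg par) (Nbr par) (Nbus par) (sthr par)
        (fun t => (zF r t).1.1) (fun t => (zF r t).1.2) (scr r) &
      forall t, solve (Z_F t (pbar r n) (ubar r n) (Some (scr r))
                           (deltam r) (deltap r))
                      (zfinal r t)].

Definition padm_returns (par : padm_params) (p : period -> per_p)
    (q : period -> per_q) (u : period -> per_u) : Prop :=
  exists2 r : padm_run, valid_run par r &
    forall t, zfinal r t = (p t, q t, u t).

End Model.

(* Main.v *)
(** The commitments returned are those of the last bus subproblem, which satisfy
    (U), and the last period subproblem yields the remaining constraints except
    for the ramping limits (R).  Moving [p^tot] within the deviations
    [[- delta^-, delta^+]] changes the increment from [t - 1] to [t] by at least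
    [- delta^-_t - delta^+_{t-1}] and at most [delta^+_t + delta^-_{t-1}], which
    is exactly what the constraints of [H_j] allow for.  Rounding a point between
    two integral shunt bounds to a nearest integer stays between them. *)
Require Import Defs.
From HB Require Import structures.
From mathcomp Require Import all_boot all_order all_algebra.
From mathcomp Require Import all_classical all_reals all_analysis.
From mathcomp Require Import lra.
Import Order.TTheory GRing.Theory Num.Theory.
Local Open Scope ring_scope.

Section Feasibility.
Variables (R : realType) (S : index_sets) (D : scuc_data R S).

Lemma Z_SH_feasible (x : Jsh S -> R) :
  (forall j, (ushmin D j <= ushmax D j)%N) ->
  constr_F4 D (fun j => Z_SH D j (x j)).
Proof.
move=> le_ush j; rewrite /Z_SH.
set y := Num.max _ _.
have le_min : (ushmin D j)%:R <= y by rewrite le_max lexx.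
have le_max : y <= (ushmax D j)%:R.
  by rewrite ge_max ler_nat le_ush ge_min lexx orbT.
have ge_floor : ((ushmin D j)%:Z <= Num.floor (2^-1 + y)).
  by rewrite floor_ge_int -pmulrn; lra.
have floor_le : (Num.floor (2^-1 + y) <= (ushmax D j)%:Z).
  by rewrite -ltzD1 floor_lt_int intrD -pmulrn; lra.
(* The lower bound is a natural number, so a negative floor is impossible. *)
case: (Num.floor _) ge_floor floor_le => // n; rewrite !lez_nat => lo hi.
by rewrite -pmulrn !ler_nat lo hi natr_nat.
Qed.

Lemma ramping_preserved (j : Jsd S) (p pb : period S -> dev_p R S)
    (u : period S -> dev_u R) (dm dp : period S -> R) :
  feasible (H D j pb u) (dm, dp) ->
  (forall t, ptot (pb t) - dm t <= ptot (p t) <= ptot (pb t) + dp t) ->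
  forall t, constr_R D j t p u.
Proof.
move=> Hd near_pb t; have [] := Hd t.
rewrite /constr_R /ptot_incr /lag /=; have := near_pb t.
(* In the first period, [p] and [pb] share the predecessor [ptot0 D j], and the earlier deviations
   are 0. *)
case: ifP => [_|_]; first by move=> /andP[] ? ? ? ? _ _; apply/andP; split; lra.
set s := Ordinal _; have /andP[? ?] := near_pb s.
by move=> /andP[] ? ? ? ? _ _; apply/andP; split; lra.
Qed.

(** The data do not order these bounds; any feasible point lies between them, and the standing
    assumption supplies one. *)
Lemma shunt_bounds_le (x : scuc_point R S) (t : period S) (j : Jsh S) :
  feasible (scuc_acopf D) x -> (ushmin D j <= ushmax D j)%N.
Proof.
case: x => [[[p q] u] w] [_ /(_ t)[_ _ _ /(_ j)[/andP[lo hi] _]]].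
by rewrite -(ler_nat R) (le_trans lo hi).
Qed.

End Feasibility.

Theorem theorem3 (R : realType) (S : index_sets) (D : scuc_data R S)
    (par : padm_params R)
    (p : period S -> per_p R S) (q : period S -> per_q R S)
    (u : period S -> per_u R S) :
  standing_assumption D ->
  padm_returns D par p q u ->
  exists w : period S -> ac_state R S,
    feasible (scuc_acopf D) (p, q, u, w).
Proof.
move=> [_ _ _ [[x0 x0_feas] _]] [r [iters dev_opt _ _ final] ret].
set n := nIter par in iters dev_opt final *.
have [_ bus_feas ush_eq] : valid_iteration D par r n.
  by apply: iters; rewrite leqnn andbT nIter_gt0.
have uE : u = ubar r n.
  by apply: funext => t; have := final t; rewrite ret => -[].
have /boolp.choice[w wP] : forall t, exists w : ac_state R S,
    [/\ constr_F1 D (pflow (p t)) (qflow (q t)) w,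
        constr_F2 D (pflow (p t)) (qflow (q t)) (ush (u t)) w &
        constr_F3 D (pflow (p t)) (qflow (q t)) w].
  by move=> t; have := final t; rewrite ret => -[].
exists w; split=> [j | t]; last first.
  have [F1 F2 F3] := wP t; split=> //.
  rewrite uE (funext (ush_eq^~ t)).
  by apply: Z_SH_feasible => j; apply: shunt_bounds_le t j x0_feas.
(* Device [j] is constrained in the subproblem of its own bus. *)
have [uU _] := bus_feas (dev_bus D j) j erefl.
split=> [|t]; first by rewrite uE.
have := final t; rewrite ret => -[/(_ j)[P1 P2 P3 P4 Q] _ _ _].
rewrite uE in P3 *; do 2!split=> //.
apply: ramping_preserved (dev_opt j).1 _ _ => s.
by have := final s; rewrite ret => -[].
Qed.
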